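(* Let $\mathbb G$, $d$, $\phi$, $\mathcal V$ be as in the context. Assume $x_0\in\mathbb R^q\setminus\{0\}$ and $\theta_0\in\mathcal V$, and define the curve $\gamma(s)=(x(s),t(s))$, $0\le s\le1$, by $$x(s)=\frac{\sin(sU(\theta_0))}{\sin U(\theta_0)}e^{(s-1)\widetilde U(\theta_0)}x_0,\qquad t(s)=\frac12\int_0^s\langle\mathbb U x(r),\zeta(r)\rangle\,dr,\qquad \zeta(s)=\frac{U(\theta_0)}{\sin U(\theta_0)}e^{(2s-1)\widetilde U(\theta_0)}x_0 .$$ If $\theta_0$ is a critical point of $\phi(g_0;\cdot)$ for some $g_0=(x_0,t_0)$, then $\gamma$ is a horizontal curve with $\gamma(0)=o$ and $\gamma(1)=g_0$, and $$d(g_0)^2\le\ell(\gamma)^2=\Big|\frac{U(\theta_0)}{\sin U(\theta_0)}x_0\Big|^2=\phi(g_0;\theta_0).$$ Conversely, with $t_0=t(1)$ and $g_0=(x_0,t_0)$, $\theta_0$ is a critical point of $\phi(g_0;\cdot)$.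
   Context: Let $q,m\ge1$, $U^{(1)},\dots,U^{(m)}$ linearly independent real skew-symmetric $q\times q$ matrices; $\mathbb G=\mathbb R^q\times\mathbb R^m$ with law $(x,t)\cdot(x',t')=(x+x',t+t'+\frac12\langle\mathbb Ux,x'\rangle)$, $\langle\mathbb Ux,x'\rangle=(\langle U^{(j)}x,x'\rangle)_{j}$, identity $o$. A horizontal curve is an absolutely continuous $(x(s),t(s))$ with $t'=\frac12\langle\mathbb Ux,x'\rangle$; its length is $\ell=\int_0^1|x'(s)|ds$, and $d(g)$ is the infimum of lengths of horizontal curves from $o$ to $g$ (Carnot–Carathéodory distance). $\widetilde U(\tau)=\sum_j\tau_jU^{(j)}$, $U(\tau)=i\widetilde U(\tau)$. $\mathcal V=\{\vartheta\in\mathbb R^m:\det(k\pi\mathbb I_q-U(\vartheta))\ne0\ \forall k\in\mathbb N^*\}$. For $\vartheta$ in $\mathcal V$ (so that no eigenvalue of $U(\vartheta)$ lies in $\pi\mathbb Z\setminus\{0\}$), $\phi((x,t);\vartheta)=\langle U(\vartheta)\cot U(\vartheta)x,x\rangle+4t\cdot\vartheta$, which is smooth near $\vartheta$. Matrix functions are defined by functional calculus, with the convention $\frac{\sin(s\cdot0)}{\sin0}=s$ and $\frac{0}{\sin0}=1$. *)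

(* Defs.v *)
From HB Require Import structures.
From mathcomp Require Import all_boot all_order all_algebra.
From mathcomp Require Import all_classical all_reals all_analysis.
From mathcomp Require Import complex.
From Stdlib Require Import ClassicalEpsilon.

Set Implicit Arguments.
Unset Strict Implicit.
Unset Printing Implicit Defensive.
Import Order.TTheory GRing.Theory Num.Theory.
Import numFieldNormedType.Exports.
Local Open Scope classical_set_scope.
Local Open Scope ring_scope.

Section Defs.
Variable R : realType.

Local Notation C := (complex.complex R).

Definition RtoC (r : R) : C := complex.Complex r 0.
Definition conjc (z : C) : C := complex.Complex (complex.Re z) (- complex.Im z).
Definition adjmx n (A : 'M[C]_n) : 'M[C]_n := (map_mx conjc A)^T.
Definition unitarymx n (P : 'M[C]_n) : Prop := P *m adjmx P = 1%:M.

(* Functional calculus of a Hermitian matrix H = P diag(d) P^* (P unitary,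
   d real): f(H) := P diag(f(d)) P^*.  The decomposition is chosen by
   Hilbert's epsilon; the result does not depend on the choice. *)
Definition spectral_decomp n (H : 'M[C]_n) : 'M[C]_n * 'rV[C]_n :=
  epsilon (inhabits (0, 0))
    (fun pd : 'M[C]_n * 'rV[C]_n =>
       [/\ unitarymx pd.1, (forall i, complex.Im (pd.2 0 i) = 0)
         & H = pd.1 *m diag_mx pd.2 *m adjmx pd.1]).

Definition fcalc n (f : R -> R) (H : 'M[C]_n) : 'M[C]_n :=
  let pd := spectral_decomp H in
  pd.1 *m diag_mx (map_mx (fun z => RtoC (f (complex.Re z))) pd.2)
       *m adjmx pd.1.

Definition expmx n (A : 'M[R]_n) : 'M[R]_n :=
  \matrix_(i, j) limn (fun N : nat => \sum_(k < N) (A ^+ k) i j / (k`!)%:R).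

Definition dotv n (a b : 'cV[R]_n) : R := \sum_(i < n) a i 0 * b i 0.
Definition normv n (a : 'cV[R]_n) : R := Num.sqrt (dotv a a).

Variables (q m : nat) (Us : 'I_m -> 'M[R]_q).

Definition Utilde (tau : 'cV[R]_m) : 'M[R]_q := \sum_(j < m) tau j 0 *: Us j.
Definition Uc (tau : 'cV[R]_m) : 'M[C]_q :=
  map_mx (fun r => complex.Complex 0 r) (Utilde tau).
(* f(U(tau)) for the (even) scalar functions f used below; these matrices
   are real, we keep their (real) entries. *)
Definition mxf (f : R -> R) (tau : 'cV[R]_m) : 'M[R]_q :=
  map_mx (@complex.Re R) (fcalc f (Uc tau)).

Definition sin_ratio (s : R) (l : R) : R :=
  if l == 0 then s else sin (s * l) / sin l.
Definition xcot (l : R) : R := if l == 0 then 1 else l * cos l / sin l.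
Definition xcsc (l : R) : R := if l == 0 then 1 else l / sin l.

Definition inV (th : 'cV[R]_m) : Prop :=
  forall k : nat, (0 < k)%N ->
    \det ((RtoC (k%:R * pi))%:M - Uc th) != 0.

Definition phi (g : 'cV[R]_q * 'cV[R]_m) (th : 'cV[R]_m) : R :=
  dotv (mxf xcot th *m g.1) g.1 + 4 * dotv g.2 th.

Definition critical (f : 'cV[R]_m -> R) (th0 : 'cV[R]_m) : Prop :=
  forall j : 'I_m,
    derivable (fun h : R => f (th0 + h *: delta_mx j 0)) 0 1 /\
    derive1 (fun h : R => f (th0 + h *: delta_mx j 0)) 0 = 0.

Definition abs_cont (f : R -> R) (a b : R) : Prop :=
  forall e : R, 0 < e -> exists2 d : R, 0 < d &
    forall (n : nat) (u v : 'I_n -> R),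
      (forall k, a <= u k /\ u k <= v k /\ v k <= b) ->
      (forall k l, k != l -> v k <= u l \/ v l <= u k) ->
      \sum_(k < n) (v k - u k) < d ->
      \sum_(k < n) `|f (v k) - f (u k)| < e.

Definition curve := R -> 'cV[R]_q * 'cV[R]_m.

Definition xdot (gam : curve) (s : R) : 'cV[R]_q :=
  \col_i derive1 (fun r => (gam r).1 i 0) s.

Definition horizontal (gam : curve) : Prop :=
  [/\ (forall i, abs_cont (fun s => (gam s).1 i 0) 0 1),
      (forall j, abs_cont (fun s => (gam s).2 j 0) 0 1)
    & {ae (@lebesgue_measure R), forall s : R, 0 <= s <= 1 ->
        (forall i, derivable (fun r => (gam r).1 i 0) s 1) /\
        (forall j, derivable (fun r => (gam r).2 j 0) s 1 /\
           derive1 (fun r => (gam r).2 j 0) s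
             = 2^-1 * dotv (Us j *m (gam s).1) (xdot gam s))}].

Definition len (gam : curve) : \bar R :=
  (\int[@lebesgue_measure R]_(s in `[0%R, 1%R]%classic) (normv (xdot gam s))%:E)%E.

Definition origin : 'cV[R]_q * 'cV[R]_m := (0, 0).

Definition ccdist (g : 'cV[R]_q * 'cV[R]_m) : \bar R :=
  ereal_inf [set len gam | gam in
    [set gam : curve | horizontal gam /\ gam 0 = origin /\ gam 1 = g]].

Variables (x0 : 'cV[R]_q) (th0 : 'cV[R]_m).

Definition xcurve (s : R) : 'cV[R]_q :=
  mxf (sin_ratio s) th0 *m (expmx ((s - 1) *: Utilde th0) *m x0).
Definition zeta (s : R) : 'cV[R]_q :=
  mxf xcsc th0 *m (expmx ((2 * s - 1) *: Utilde th0) *m x0).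
Definition tcurve (s : R) : 'cV[R]_m :=
  \col_j (2^-1 * Rintegral (@lebesgue_measure R) `[0, s]
                   (fun r => dotv (Us j *m xcurve r) (zeta r))).
Definition gamma : curve := fun s => (xcurve s, tcurve s).

End Defs.

(* Main.v *)
Require Import Defs.
From HB Require Import structures.
From mathcomp Require Import all_boot all_order all_algebra.
From mathcomp Require Import all_classical all_reals all_analysis.
From mathcomp Require Import complex ring lra.
From Stdlib Require Import ClassicalEpsilon.
Import Order.TTheory GRing.Theory Num.Theory.
Import numFieldNormedType.Exports.
Local Open Scope classical_set_scope.
Local Open Scope ring_scope.

(** The matrix functions of H = i Utilde(theta) act, on the real side, as the
    functional calculus of the skew matrix W = Utilde(theta).  With
    c = U/sin U x_0 one has x(s) = Y(s) c and x'(s) = exp((2s-1)W) c, so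
    x'' = 2 W x', |x'| = |c|, x(0) = 0, x(1) = x_0 and
    x'(1) = (U cot U + W) x_0.

    For the derivative of F(h) = <U cot U x_0, x_0> at theta_0 + h e_j, take the
    curves x_h joining 0 to x_0 for W_h = W + h B, B = U^(j).  The derivative of
    <x_h' - W_h x_h, x_0> - <x_0' - W x_0, x_h> + h <B x_0, x_h>
    + 2 h int <B x_0, x_0'> in s is -2 h <B (x_h - x_0), x_0'>, which is O(h^2)
    because x_h depends on h in a Lipschitz way; hence
    F'(0) = - 2 int_0^1 <B x_0, x_0'> = - 4 t_j(1), and criticality of phi(g_0; .)
    means t_0 = t(1). *)

Set Implicit Arguments.
Unset Strict Implicit.
Unset Printing Implicit Defensive.

(** * Functional calculus of the Hermitian matrix iW attached to a real skew matrix W *)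

Section FunctionalCalculus.
Variables (R : realType) (q : nat).
Local Notation C := (complex.complex R).
Local Notation "x %:C" := (real_complex R x) : ring_scope.
Implicit Types (W : 'M[R]_q) (f g : R -> C) (A B : 'M[C]_q).

Definition imx W : 'M[C]_q := map_mx (fun r => complex.Complex 0 r) W.

Lemma conjcE (z : C) : Defs.conjc z = (z^*)%R.
Proof. by case: z. Qed.

Local Notation cmx := (@map_mx _ _ (@Defs.conjc R) q q).

Lemma conjmxM A B : cmx (A *m B) = cmx A *m cmx B.
Proof. by rewrite (funext conjcE : @Defs.conjc R = _); exact: map_mxM. Qed.

Lemma conjmx1 : cmx 1%:M = 1%:M.
Proof. by rewrite (funext conjcE : @Defs.conjc R = _); exact: map_mx1. Qed.

Lemma adjmxE A : adjmx A = (map_mx Num.conj A)^T.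
Proof. by apply/matrixP => i j; rewrite !mxE conjcE. Qed.

(** The choice operator meets its specification as soon as one diagonalisation exists. Skewness
    makes [imx W] Hermitian, and the spectral theorem for normal matrices then provides one, with
    real eigenvalues. *)
Lemma spectral_decompP W : W^T = - W ->
  [/\ Defs.unitarymx (spectral_decomp (imx W)).1,
      forall i, complex.Im ((spectral_decomp (imx W)).2 0 i) = 0
    & imx W = (spectral_decomp (imx W)).1 *m
              diag_mx (spectral_decomp (imx W)).2 *m
              adjmx (spectral_decomp (imx W)).1].
Proof.
move=> sW.
pose P (pd : 'M[C]_q * 'rV[C]_q) :=
  [/\ Defs.unitarymx pd.1, (forall i, complex.Im (pd.2 0 i) = 0)
         & imx W = pd.1 *m diag_mx pd.2 *m adjmx pd.1].
apply: (@epsilon_spec _ (inhabits (0, 0)) P).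
have hH : imx W \is hermsymmx.
  apply/is_hermitianmxP; rewrite expr0 scale1r.
  apply/matrixP => i j; rewrite !mxE.
  move/matrixP: sW => /(_ i j); rewrite !mxE => ->.
  by rewrite -conjcE /Defs.conjc /= opprK.
have /orthomx_spectralP eW := hermitian_normalmx hH.
have uS := spectral_unitarymx (imx W).
have aS : adjmx (invmx (spectralmx (imx W))) = spectralmx (imx W).
  by rewrite invmx_unitary // adjmxE -map_mx_comp map_mx_id ?trmxK // => z; rewrite /= conjCK.
(* With S = [spectralmx], the spectral theorem reads S^-1 D S while the specification wants P D P^*;
   hence P is S^-1, whose adjoint is S. *)
exists (invmx (spectralmx (imx W)), spectral_diag (imx W)); split => /=.
- by rewrite /Defs.unitarymx aS mulVmx // spectral_unit.
- move=> i; have /mxOverP /(_ 0 i) := hermitian_spectral_diag_real hH.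
  by move/RIm_real => [].
- by rewrite aS.
Qed.

Definition spec W (i : 'I_q) : R := complex.Re ((spectral_decomp (imx W)).2 0 i).

(** Complex symbols are allowed so that exp(sW), whose symbol is not real, lies in the same calculus
    as the even real functions of the statement. *)
Definition cfc W f : 'M[C]_q :=
  (spectral_decomp (imx W)).1 *m diag_mx (\row_i f (spec W i))
  *m adjmx (spectral_decomp (imx W)).1.

Definition rfc W f : 'M[R]_q := map_mx (@complex.Re R) (cfc W f).

Lemma fcalcE (f : R -> R) W : fcalc f (imx W) = cfc W (fun l => (f l)%:C).
Proof.
by rewrite /fcalc /cfc; congr (_ *m diag_mx _ *m _); apply/rowP => i; rewrite !mxE.
Qed.

Lemma cfc_ext W f g : (forall i, f (spec W i) = g (spec W i)) -> cfc W f = cfc W g.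
Proof.
move=> fg; rewrite /cfc; congr (_ *m diag_mx _ *m _).
by apply/rowP => i; rewrite !mxE.
Qed.

Lemma rfc_ext W f g : (forall i, f (spec W i) = g (spec W i)) -> rfc W f = rfc W g.
Proof. by move=> /cfc_ext; rewrite /rfc => ->. Qed.

Section Skew.
Variable W : 'M[R]_q.
Hypothesis sW : W^T = - W.
Local Notation P := (spectral_decomp (imx W)).1.

Let PP : P *m adjmx P = 1%:M. Proof. by have [] := spectral_decompP sW. Qed.
Let PP' : adjmx P *m P = 1%:M. Proof. exact: mulmx1C. Qed.

Lemma cfcM f g : cfc W f *m cfc W g = cfc W (fun l => f l * g l).
Proof.
rewrite /cfc -!mulmxA (mulmxA (adjmx P)) PP' mul1mx (mulmxA (diag_mx _)) mulmx_diag.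
by congr (_ *m (diag_mx _ *m _)); apply/rowP => i; rewrite !mxE.
Qed.

Lemma cfcD f g : cfc W f + cfc W g = cfc W (fun l => f l + g l).
Proof.
rewrite /cfc -mulmxDl -mulmxDr -raddfD /=.
by congr (_ *m diag_mx _ *m _); apply/rowP => i; rewrite !mxE.
Qed.

Lemma cfcZ a f : a *: cfc W f = cfc W (fun l => a * f l).
Proof.
rewrite /cfc scalemxAl scalemxAr -linearZ /=.
by congr (_ *m diag_mx _ *m _); apply/rowP => i; rewrite !mxE.
Qed.

Lemma cfc1 : cfc W (fun=> 1) = 1%:M.
Proof.
rewrite /cfc [diag_mx _](_ : _ = 1%:M) ?mulmx1 //.
by apply/matrixP => i j; rewrite !mxE.
Qed.

Lemma cfc_id : cfc W (fun l => l%:C) = imx W.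
Proof.
have [_ dr eW] := spectral_decompP sW.
rewrite [RHS]eW /cfc; congr (_ *m diag_mx _ *m _); apply/rowP => i.
by rewrite mxE /spec; move: (dr i); case: ((spectral_decomp _).2 0 i) => a b /= ->.
Qed.

Lemma cfc_adj f : adjmx (cfc W f) = cfc W (fun l => Defs.conjc (f l)).
Proof.
rewrite /cfc /adjmx !conjmxM !trmx_mul /= mulmxA map_trmx trmxK -map_mx_comp.
rewrite (map_mx_id (f := _ \o _)); last by move=> z; rewrite /= !conjcE conjCK.
congr (_ *m _ *m _); apply/matrixP => i j; rewrite !mxE eq_sym.
by case: eqP => [->|]; rewrite ?mulr1n // !mulr0n conjcE conjC0.
Qed.

Lemma det_cfc f : \det (cfc W f) = \prod_i f (spec W i).
Proof.
rewrite /cfc !det_mulmx mulrAC -det_mulmx PP det1 mul1r det_diag.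
by apply: eq_bigr => i _; rewrite mxE.
Qed.

Lemma tr_imx : (imx W)^T = - imx W.
Proof.
apply/matrixP => i j; rewrite !mxE; move/matrixP: sW => /(_ i j); rewrite !mxE => ->.
by apply/eqP; rewrite eq_complex /= oppr0 !eqxx.
Qed.

(** With a = k pi and b = 1 or -1, this turns the determinants that define [inV] into products over
    the eigenvalues. *)
Lemma det_pencil (a b : R) :
  \det (a%:C%:M + b%:C *: imx W) = \prod_i (a + b * spec W i)%:C.
Proof.
rewrite -(det_cfc (fun l => (a + b * l)%:C)); congr (\det _).
rewrite (@cfc_ext W _ (fun l => a%:C * 1 + b%:C * l%:C)) => [|i].
  by rewrite -cfcD -!cfcZ cfc1 cfc_id scalemx1.
by rewrite mulr1 rmorphD rmorphM.
Qed.

(** The symmetry of the symbol that makes f(iW) a real matrix. Real even functions have it, and so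
    does l -> e^(-isl). *)
Definition csym f := forall l, f (- l) = Defs.conjc (f l).

(* The conjugate of H = iW is -H, so the matrix [Q] intertwining the two
   eigenbases only couples opposite eigenvalues. *)
Lemma cfc_real f : csym f -> cmx (cfc W f) = cfc W f.
Proof.
move=> sf; pose cP := cmx P; pose Q := adjmx P *m cP.
pose D h : 'M[C]_q := diag_mx (\row_i h (spec W i)).
have cPP : cmx (adjmx P) *m cP = 1%:M.
  by rewrite /cP -conjmxM PP' conjmx1.
have cD h : cmx (D h) = D (fun l => Defs.conjc (h l)).
  apply/matrixP => i j; rewrite !mxE; case: eqP => _; rewrite ?mulr1n //.
  by rewrite !mulr0n conjcE conjC0.
have cH : cmx (imx W) = - imx W.
  by apply/matrixP => i j; rewrite !mxE /Defs.conjc; apply/eqP; rewrite eq_complex /= oppr0 !eqxx.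
have HQ : D (fun l => l%:C) *m Q = - (Q *m D (fun l => l%:C)).
  have H1 : adjmx P *m imx W = D (fun l => l%:C) *m adjmx P.
    by rewrite -[X in _ *m X = _]cfc_id /cfc !mulmxA PP' mul1mx.
  have H2 : imx W *m cP = - (cP *m D (fun l => l%:C)).
    have -> : imx W *m cP = - (cmx (cfc W (fun l => l%:C)) *m cP).
      by rewrite cfc_id cH mulNmx opprK.
    rewrite /cfc !conjmxM -/cP -!mulmxA cPP.
    rewrite mulmx1 cD; congr (- (_ *m diag_mx _)); apply/rowP => i.
    by rewrite !mxE /Defs.conjc /= oppr0.
  by rewrite /Q mulmxA -H1 -(mulmxA (adjmx P) (imx W)) H2 mulmxN mulmxA.
have fQ : D f *m Q = Q *m D (fun l => Defs.conjc (f l)).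
  apply/matrixP => i j; rewrite mul_diag_mx mul_mx_diag !mxE.
  move/matrixP: HQ => /(_ i j); rewrite mul_diag_mx mul_mx_diag !mxE.
  move/eqP; rewrite -subr_eq0 opprK [_ * (spec W j)%:C]mulrC -mulrDl mulf_eq0.
  move=> /orP [/eqP e | /eqP ->]; last by rewrite mulr0 mul0r.
  rewrite mulrC; congr (_ * _).
  suff -> : spec W i = - spec W j by rewrite sf.
  by apply/eqP; rewrite -subr_eq0 opprK; move: e => [->].
rewrite /cfc !conjmxM -/cP.
have -> : cP = P *m Q by rewrite /Q mulmxA PP mul1mx.
have QP : Q *m cmx (adjmx P) = adjmx P.
  by rewrite /Q -mulmxA -conjmxM PP conjmx1 mulmx1.
by rewrite -/(D f) cD -(mulmxA P Q) -fQ (mulmxA P) -(mulmxA (P *m _)) QP.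
Qed.

Lemma map_rfc f : csym f -> map_mx (real_complex R) (rfc W f) = cfc W f.
Proof.
move=> /cfc_real /matrixP e; apply/matrixP => i j; rewrite mxE [rfc _ _ _ _]mxE.
by move: (e i j); rewrite mxE conjcE => /CrealP /RRe_real.
Qed.

End Skew.
End FunctionalCalculus.

(** * Differentiation rules and a mean value inequality for scalar functions *)

Section PointwiseDerivatives.
Variable R : realType.
Implicit Types (f g : R -> R) (x c : R).

Lemma derive_cst c x : is_derive x (1:R) (fun=> c) 0.
Proof. exact: is_derive_cst. Qed.

Lemma derive_idfun x : is_derive x (1:R) (fun s => s) 1.
Proof. exact: is_derive_id. Qed.

Lemma derive_add f g x df dg : is_derive x (1:R) f df -> is_derive x (1:R) g dg ->
  is_derive x (1:R) (fun s => f s + g s) (df + dg).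
Proof. exact: is_deriveD. Qed.

Lemma derive_sub f g x df dg : is_derive x (1:R) f df -> is_derive x (1:R) g dg ->
  is_derive x (1:R) (fun s => f s - g s) (df - dg).
Proof. exact: is_deriveB. Qed.

Lemma derive_opp f x df : is_derive x (1:R) f df ->
  is_derive x (1:R) (fun s => - f s) (- df).
Proof. exact: is_deriveN. Qed.

Lemma derive_mul f g x df dg : is_derive x (1:R) f df -> is_derive x (1:R) g dg ->
  is_derive x (1:R) (fun s => f s * g s) (df * g x + f x * dg).
Proof.
move=> Df Dg; rewrite addrC [df * _]mulrC.
exact: is_deriveM.
Qed.

Lemma derive_scale c f x df : is_derive x (1:R) f df ->
  is_derive x (1:R) (fun s => c * f s) (c * df).
Proof. exact: is_deriveZ. Qed.

Lemma derive_sum n (h : 'I_n -> R -> R) x (dh : 'I_n -> R) :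
  (forall i, is_derive x (1:R) (h i) (dh i)) ->
  is_derive x (1:R) (fun s => \sum_i h i s) (\sum_i dh i).
Proof. by move=> /is_derive_sum; rewrite fct_sumE. Qed.

Lemma derive_comp f g x df dg : is_derive x (1:R) g dg ->
  is_derive (g x) (1:R) f df -> is_derive x (1:R) (fun s => f (g s)) (df * dg).
Proof. by move=> Dg Df; exact: is_derive1_comp. Qed.

Lemma derive_linear_cos a b x :
  is_derive x (1:R) (fun s => cos (a * s + b)) (- (a * sin (a * x + b))).
Proof.
have D : is_derive x (1:R) (fun s => a * s + b) a.
  by have := derive_add (derive_scale a (derive_idfun x)) (derive_cst b x); rewrite mulr1 addr0.
have := derive_comp D (is_derive_cos (a * x + b)).
by rewrite mulNr mulrC.
Qed.

Lemma derive_linear_sin a b x :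
  is_derive x (1:R) (fun s => sin (a * s + b)) (a * cos (a * x + b)).
Proof.
have D : is_derive x (1:R) (fun s => a * s + b) a.
  by have := derive_add (derive_scale a (derive_idfun x)) (derive_cst b x); rewrite mulr1 addr0.
have := derive_comp D (is_derive_sin (a * x + b)).
by rewrite mulrC.
Qed.

(** Used in place of integrating [df]: applied to a function and to its opposite, it gives two-sided
    bounds, and constancy when the derivative is 0. *)
Lemma derive_mean_value f (df : R -> R) (a b M : R) : a <= b ->
  (forall s, a <= s <= b -> is_derive s (1:R) f (df s)) ->
  (forall s, a <= s <= b -> df s <= M) ->
  f b - f a <= M * (b - a).
Proof.
rewrite le_eqVlt => /orP [/eqP -> | ab] D dM; first by rewrite !subrr mulr0.
have [||c cab ->] := @MVT R f df a b ab.
- by move=> s; rewrite in_itv /= => /andP [? ?]; apply: D; rewrite !ltW.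
- apply: derivable_within_continuous => s; rewrite in_itv /= => sab.
  by have [] := D s sab.
by rewrite ler_pM2r ?subr_gt0 // dM //; move: cab; rewrite in_itv /= => /andP [? ?]; rewrite !ltW.
Qed.

Lemma derive_ext f g x df : f =1 g -> is_derive x (1:R) f df -> is_derive x (1:R) g df.
Proof. by move=> /funext ->. Qed.

End PointwiseDerivatives.

(** * Real matrices f(iW), their derivatives in a parameter, and the exponential *)

Section RealCalculus.
Variables (R : realType) (q : nat) (W : 'M[R]_q).
Hypothesis sW : W^T = - W.
Local Notation C := (complex.complex R).
Local Notation "x %:C" := (real_complex R x) : ring_scope.
Implicit Types (f g : R -> C).

Lemma csymM f g : csym f -> csym g -> csym (fun l => f l * g l).
Proof. by move=> sf sg l; rewrite sf sg !conjcE rmorphM. Qed.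

Lemma csym_real (f : R -> R) : (forall l, f (- l) = f l) -> csym (fun l => (f l)%:C).
Proof. by move=> fN l; rewrite fN /Defs.conjc /= oppr0. Qed.

Lemma rfcM f g : csym f -> csym g -> rfc W f *m rfc W g = rfc W (fun l => f l * g l).
Proof.
move=> sf sg; apply: (@map_mx_inj _ _ (real_complex R)).
apply: etrans (map_mxM _ _ _) _.
apply: etrans (congr2 mulmx (map_rfc sW sf) (map_rfc sW sg)) _.
by rewrite (cfcM sW); apply/esym/map_rfc => //; exact: csymM.
Qed.

(** The coefficients come from P_ik conj(P_jk) and are chosen before [f]. Each entry is thus a fixed
    real-linear form in the values of [f] on the spectrum, so sums, derivatives and limits in [f]
    pass to the matrix. *)
Lemma rfc_entry i j : exists ab : 'I_q -> R * R, forall f,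
  rfc W f i j = \sum_k (complex.Re (f (spec W k)) * (ab k).1 -
                        complex.Im (f (spec W k)) * (ab k).2).
Proof.
pose P := (spectral_decomp (imx W)).1.
exists (fun k => (complex.Re (P i k * Defs.conjc (P j k)),
          complex.Im (P i k * Defs.conjc (P j k)))) => f /=.
rewrite mxE /cfc mul_mx_diag mxE /= (raddf_sum (@complex.Re R : Rcomplex R -> R)).
apply: eq_bigr => k _; rewrite !mxE -/P.
by case: (P i k) (P j k) (f _) => [a b] [c d] [x y] /=; ring.
Qed.

Lemma rfcD f g : rfc W f + rfc W g = rfc W (fun l => f l + g l).
Proof.
apply/matrixP => i j; have [ab e] := rfc_entry i j.
rewrite mxE.
apply: etrans (congr2 +%R (e f) (e g)) (esym (etrans (e _) _)).
rewrite -big_split; apply: eq_bigr => k _ /=.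
by case: (f _) (g _) => [a b] [c d] /=; ring.
Qed.

Lemma rfcZ (a : R) f : a *: rfc W f = rfc W (fun l => a%:C * f l).
Proof.
apply/matrixP => i j; have [ab e] := rfc_entry i j.
rewrite mxE.
apply: etrans (congr1 ( *%R a) (e f)) (esym (etrans (e _) _)).
rewrite mulr_sumr; apply: eq_bigr => k _ /=.
by case: (f _) => [c d] /=; ring.
Qed.

Lemma rfc1 : rfc W (fun=> 1) = 1%:M.
Proof.
rewrite /rfc cfc1 //; apply/matrixP => i j; rewrite !mxE; by case: eqP.
Qed.

(** With H = iW one has W = -iH, so the symbol of [W] is -il. *)
Lemma rfc_skew : rfc W (fun l => complex.Complex 0 (- l)) = W.
Proof.
rewrite /rfc (@cfc_ext _ _ _ _ (fun l => complex.Complex 0 (- 1) * l%:C)); last first.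
  by move=> i; apply/eqP; rewrite eq_complex /=; apply/andP; split; apply/eqP; ring.
rewrite -cfcZ cfc_id //; apply/matrixP => i j; rewrite !mxE /=.
by rewrite mul0r sub0r mulN1r opprK.
Qed.

(** The transpose of the real part of a matrix is the real part of its adjoint. *)
Lemma tr_rfc f : (rfc W f)^T = rfc W (fun l => Defs.conjc (f l)).
Proof.
rewrite /rfc -cfc_adj; apply/matrixP => i j.
by rewrite mxE [LHS]mxE [RHS]mxE 2![in RHS]mxE.
Qed.

Lemma det_rfc f : csym f -> (\det (rfc W f))%:C = \prod_i f (spec W i).
Proof. by move=> sf; rewrite -det_map_mx map_rfc // det_cfc. Qed.

Lemma is_derive_rfc (f : R -> R -> C) (g : R -> C) s i j :
  (forall l, is_derive s (1:R) (fun s => complex.Re (f s l)) (complex.Re (g l))) ->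
  (forall l, is_derive s (1:R) (fun s => complex.Im (f s l)) (complex.Im (g l))) ->
  is_derive s (1:R) (fun s => rfc W (f s) i j) (rfc W g i j).
Proof.
move=> dr di; have [ab e] := rfc_entry i j.
apply: (@derive_ext _ _ _ _ _ (fun s => esym (e (f s)))); rewrite (e g).
apply: derive_sum => k; apply: derive_sub.
  have := derive_mul (dr (spec W k)) (derive_cst (ab k).1 s).
  by rewrite mulr0 addr0.
have := derive_mul (di (spec W k)) (derive_cst (ab k).2 s).
by rewrite mulr0 addr0.
Qed.

(** This is e^(-isl), the symbol of exp(sW) because W = -iH. *)
Definition cexp (s l : R) : C := complex.Complex (cos (s * l)) (- sin (s * l)).

(** Divided by n!, this says that the terms of the series of e^(-ix) split into those of cos x and
    -sin x; it links the matrix series to the two scalar ones. *)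
Lemma imag_expr x n : complex.Complex 0 (- x) ^+ n =
  complex.Complex (n`!%:R * cos_coeff x n) (- (n`!%:R * sin_coeff x n)) :> C.
Proof.
rewrite /cos_coeff /sin_coeff /=.
have f0 k : k`!%:R != 0 :> R by rewrite pnatr_eq0 -lt0n fact_gt0.
rewrite -exprnP ![n`!%:R * _]mulrC !divfK //.
have h2 : complex.Complex 0 (- x) ^+ 2 = (- x ^+ 2)%:C :> C.
  by apply/eqP; rewrite expr2 eq_complex /=; apply/andP; split; apply/eqP; ring.
have xE : x ^+ n = x ^+ odd n * (x ^+ 2) ^+ n./2.
  by rewrite -exprM mul2n -exprD odd_double_half.
have -> : (complex.Complex 0 (- x) : C) ^+ n =
    complex.Complex 0 (- x) ^+ odd n * ((- x ^+ 2) ^+ n./2)%:C.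
  by rewrite -{1}(odd_double_half n) exprD -mul2n exprM h2 rmorphXn.
(* [sin_coeff] halves the predecessor of n, which for odd n agrees with halving n itself. *)
have nE : odd n -> n.-1./2 = n./2 by case: n {f0 xE} => //= n; rewrite uphalf_half => /negPf ->.
rewrite xE exprNn; case: (odd n) nE => [/(_ isT) ->|_]; rewrite [nat_of_bool _]/= ?(expr1, expr0).
  by apply/eqP; rewrite eq_complex /=; apply/andP; split; apply/eqP; ring.
by apply/eqP; rewrite eq_complex /=; apply/andP; split; apply/eqP; ring.
Qed.

(** Powers of [s *: W] stay in the calculus, so each entry of a partial sum is a finite combination
    of partial sums of the cosine and sine series at the eigenvalues, and these converge. *)
Lemma expmxE s : expmx (s *: W) = rfc W (cexp s).
Proof.
pose h l : C := complex.Complex 0 (- (s * l)).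
have cs : csym h by move=> l; rewrite /h /Defs.conjc /= mulrN.
have eW : s *: W = rfc W h.
  rewrite -[in LHS]rfc_skew rfcZ; apply: rfc_ext => k.
  by apply/eqP; rewrite eq_complex /=; apply/andP; split; apply/eqP; ring.
have ec k : (s *: W) ^+ k = rfc W (fun l => h l ^+ k) /\ csym (fun l => h l ^+ k).
  elim: k => [|k [IH sk]].
    by split; [rewrite expr0 rfc1|move=> l; rewrite expr0 conjcE conjC1].
  split; last by move=> l; rewrite !exprS; exact: (csymM cs sk).
  transitivity ((s *: W) *m (s *: W) ^+ k); first by rewrite exprS.
  apply: etrans (congr2 mulmx eW IH) (etrans (rfcM cs sk) _).
  by apply: rfc_ext => i; rewrite exprS.
apply/matrixP => i j; rewrite mxE; apply/cvg_lim; first exact: Rhausdorff.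
have [ab e] := rfc_entry i j; rewrite e.
rewrite (_ : (fun N => _) = (fun N => \sum_k (series (cos_coeff (s * spec W k)) N * (ab k).1 +
   series (sin_coeff (s * spec W k)) N * (ab k).2))); last first.
  apply/funext => N; rewrite [RHS](eq_bigr (fun i => \sum_(k < N)
     (cos_coeff (s * spec W i) k * (ab i).1 + sin_coeff (s * spec W i) k * (ab i).2))).
    rewrite exchange_big /=; apply: eq_bigr => k _.
    rewrite (ec k).1 e mulr_suml; apply: eq_bigr => l _.
    rewrite /h imag_expr [complex.Re _]/= [complex.Im _]/=.
    by field; rewrite pnatr_eq0 -lt0n fact_gt0.
  by move=> l _; rewrite big_split -!mulr_suml /series /= !big_mkord.
apply: (@cvg_big _ _ _ _ _ add_continuous) => k _.
rewrite mulNr opprK; apply: cvgD; apply: cvgMr_tmp.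
  by rewrite /= unlock; exact: is_cvg_series_cos_coeff.
by rewrite /= unlock; exact: is_cvg_series_sin_coeff.
Qed.

End RealCalculus.

(** * Euclidean inner product, norm estimates, and derivatives of vector curves *)

Section VectorCalculus.
Variables (R : realType) (n : nat).
Implicit Types (a b c : 'cV[R]_n) (A : 'M[R]_n) (f g : R -> 'cV[R]_n) (s k : R).

Lemma dotvE a b : dotv a b = (a^T *m b) 0 0.
Proof. by rewrite mxE; apply: eq_bigr => i _; rewrite mxE. Qed.

Lemma dotvC a b : dotv a b = dotv b a.
Proof. by apply: eq_bigr => i _; rewrite mulrC. Qed.

Lemma dotvDl a b c : dotv (a + b) c = dotv a c + dotv b c.
Proof. by rewrite !dotvE linearD mulmxDl mxE. Qed.

Lemma dotvBl a b c : dotv (a - b) c = dotv a c - dotv b c.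
Proof. by rewrite !dotvE linearB mulmxBl !mxE. Qed.

Lemma dotvZl k a b : dotv (k *: a) b = k * dotv a b.
Proof. by rewrite !dotvE linearZ -scalemxAl mxE. Qed.

Lemma dotvDr a b c : dotv c (a + b) = dotv c a + dotv c b.
Proof. by rewrite dotvC dotvDl !(dotvC c). Qed.

Lemma dotvBr a b c : dotv c (a - b) = dotv c a - dotv c b.
Proof. by rewrite dotvC dotvBl !(dotvC c). Qed.

Lemma dotvZr k a b : dotv b (k *: a) = k * dotv b a.
Proof. by rewrite dotvC dotvZl dotvC. Qed.

Lemma dotv0l a : dotv 0 a = 0.
Proof. by rewrite dotvE linear0 mul0mx mxE. Qed.

Lemma dotv0r a : dotv a 0 = 0.
Proof. by rewrite dotvC dotv0l. Qed.

Lemma dotv_adj A a b : dotv (A *m a) b = dotv a (A^T *m b).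
Proof. by rewrite !dotvE trmx_mul mulmxA. Qed.

Lemma dotv_skew A a b : A^T = - A -> dotv (A *m a) b = - dotv (A *m b) a.
Proof. by move=> sA; rewrite dotv_adj sA dotvC mulNmx -scaleN1r dotvZl mulN1r. Qed.

Lemma dotv_skew0 A a : A^T = - A -> dotv (A *m a) a = 0.
Proof. by move=> /(dotv_skew a a) e; apply/eqP; move: e; lra. Qed.

Lemma dotv_ge0 a : 0 <= dotv a a.
Proof. by apply: sumr_ge0 => i _; rewrite -expr2 sqr_ge0. Qed.

Lemma sqr_normv a : normv a ^+ 2 = dotv a a.
Proof. by rewrite sqr_sqrtr // dotv_ge0. Qed.

Lemma normv_ge0 a : 0 <= normv a.
Proof. exact: sqrtr_ge0. Qed.

Lemma normv_eq0 a : normv a = 0 -> a = 0.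
Proof.
move=> a0; have := sqr_normv a; rewrite a0 expr0n /= => /esym/eqP.
rewrite psumr_eq0 => [/allP z|i _]; last by rewrite -expr2 sqr_ge0.
apply/colP => i; rewrite mxE; apply/eqP.
by have := z i (mem_index_enum _); rewrite /= mulf_eq0 orbb.
Qed.

Lemma dotv_CS a b : dotv a b <= normv a * normv b.
Proof.
have na := normv_ge0 a; have nb := normv_ge0 b.
have [/normv_eq0 ->|a0] := eqVneq (normv a) 0.
  by rewrite dotv0l mulr_ge0 // normv_ge0.
have [/normv_eq0 ->|b0] := eqVneq (normv b) 0.
  by rewrite dotv0r mulr_ge0 // normv_ge0.
(* Expanding this square gives 2|a||b|(|a||b| - <a,b>), and the factor |a||b| is now positive. *)
have := dotv_ge0 (normv b *: a - normv a *: b).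
rewrite !(dotvBl, dotvBr, dotvZl, dotvZr) -!sqr_normv (dotvC b a).
have : 0 < normv a * normv b by rewrite mulr_gt0 // lt_def ?a0 ?b0.
move: (normv a) (normv b) (dotv a b) => x y d.
move=> xy h; rewrite -(ler_pM2l xy); lra.
Qed.

Lemma normvN a : normv (- a) = normv a.
Proof. by rewrite /normv -scaleN1r dotvZl dotvZr !mulN1r opprK. Qed.

Lemma norm_dotv a b : `|dotv a b| <= normv a * normv b.
Proof.
have := dotv_CS (-1 *: a) b; have := dotv_CS a b.
by rewrite dotvZl scaleN1r normvN ler_norml => h1 h2; apply/andP; split; lra.
Qed.

(** Testing with b = a suffices. It reduces a bound on a vector to bounds on scalar functions, where
    [derive_mean_value] applies. *)
Lemma dotv_dual a M : 0 <= M -> (forall b, dotv a b <= M * normv b) -> normv a <= M.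
Proof.
move=> M0 /(_ a); rewrite -sqr_normv expr2.
have [->//|a0] := eqVneq (normv a) 0.
by rewrite ler_pM2r // lt_def a0 normv_ge0.
Qed.

Lemma normvD a b : normv (a + b) <= normv a + normv b.
Proof.
apply: dotv_dual => [|c]; first by rewrite addr_ge0 // normv_ge0.
by rewrite dotvDl mulrDl lerD // dotv_CS.
Qed.

Lemma normv_le_sub a b : normv b <= normv a + normv (a - b).
Proof. by have := normvD a (- (a - b)); rewrite normvN opprB addrC subrK. Qed.

Lemma norm_entry a i : `|a i 0| <= normv a.
Proof.
rewrite -sqrtr_sqr ler_sqrt ?dotv_ge0 // /dotv (bigD1 i) //= -expr2 lerDl.
by apply: sumr_ge0 => j _; rewrite -expr2 sqr_ge0.
Qed.

(** Only some finite constant is wanted; the sum of the row norms is a convenient one. *)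
Lemma normv_mulmx A : exists2 K, 0 <= K & forall a, normv (A *m a) <= K * normv a.
Proof.
exists (\sum_i normv (row i A)^T); first by apply: sumr_ge0 => i _; exact: normv_ge0.
move=> a.
have entry i : (A *m a) i 0 = dotv (row i A)^T a.
  by rewrite mxE; apply: eq_bigr => j _; rewrite !mxE.
apply: dotv_dual => [|b].
  by rewrite mulr_ge0 ?normv_ge0 // sumr_ge0 // => i _; exact: normv_ge0.
rewrite [dotv _ _]/dotv mulr_suml mulr_suml; apply: ler_sum => i _; rewrite entry.
have hb := norm_entry b i.
apply: le_trans (ler_norm _) _; rewrite normrM; apply: ler_pM => //.
exact: norm_dotv.
Qed.

Definition is_derivev s f (df : 'cV[R]_n) :=
  forall i, is_derive s (1:R) (fun r => f r i 0) (df i 0).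

Lemma derivev_sub s f g df dg : is_derivev s f df -> is_derivev s g dg ->
  is_derivev s (fun r => f r - g r) (df - dg).
Proof.
move=> Df Dg i; rewrite mxE [X in _ + X]mxE.
by apply: derive_ext (derive_sub (Df i) (Dg i)) => r; rewrite !mxE.
Qed.

Lemma derivev_mulmx s A f df : is_derivev s f df ->
  is_derivev s (fun r => A *m f r) (A *m df).
Proof.
move=> Df i; rewrite mxE.
apply: derive_ext (derive_sum (fun j => derive_scale (A i j) (Df j))) => r.
by rewrite mxE.
Qed.

Lemma derive_dotv s f g df dg : is_derivev s f df -> is_derivev s g dg ->
  is_derive s (1:R) (fun r => dotv (f r) (g r)) (dotv df (g s) + dotv (f s) dg).
Proof.
move=> Df Dg; rewrite /dotv -big_split.
exact: derive_sum (fun j => derive_mul (Df j) (Dg j)).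
Qed.

Lemma derivev_cst s c : is_derivev s (fun=> c) 0.
Proof. by move=> i; rewrite mxE; exact: derive_cst. Qed.

Lemma derive_dotv_cst s f df b : is_derivev s f df ->
  is_derive s (1:R) (fun r => dotv (f r) b) (dotv df b).
Proof.
move=> Df; have := derive_dotv Df (derivev_cst s b).
by rewrite dotv0r addr0.
Qed.

End VectorCalculus.

(** * Explicit solutions of x'' = 2 W x' and the boundary values of x and x' *)

Section HorizontalLift.
Variables (R : realType) (q : nat) (W : 'M[R]_q).
Hypothesis sW : W^T = - W.
Local Notation C := (complex.complex R).
Local Notation "x %:C" := (real_complex R x) : ring_scope.

Lemma eqC (a b : C) : complex.Re a = complex.Re b -> complex.Im a = complex.Im b -> a = b.
Proof. by case: a b => [a a'] [b b'] /= -> ->. Qed.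

Definition sinc s (l : R) : R := if l == 0 then s else sin (s * l) / l.

Lemma sincN s l : sinc s (- l) = sinc s l.
Proof. by rewrite /sinc oppr_eq0 mulrN sinN invrN mulrNN. Qed.

Lemma xcscN l : xcsc (- l) = xcsc l :> R.
Proof. by rewrite /xcsc oppr_eq0 sinN invrN mulrNN. Qed.

Lemma sin_ratioN s l : sin_ratio s (- l) = sin_ratio s l :> R.
Proof. by rewrite /sin_ratio oppr_eq0 mulrN !sinN invrN mulrNN. Qed.

Lemma csym_cexp s : csym (@cexp R s).
Proof. by move=> l; rewrite /cexp /Defs.conjc /= mulrN cosN sinN. Qed.

(** This is the integral of e^(-i(2r-1)l) over r in [0,s], namely (sin(sl)/l) e^(-i(s-1)l). *)
Definition csinc s l : C := (sinc s l)%:C * cexp (s - 1) l.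

Lemma csym_csinc s : csym (csinc s).
Proof. by apply: csymM; [apply: csym_real => l; exact: sincN|exact: csym_cexp]. Qed.

Definition E s := rfc W (cexp s).
Definition Y s := rfc W (csinc s).

(** The affine argument serves both the velocity E(2s-1) and the interpolation r -> E(sr) used to
    compare two flows. *)
Lemma derive_E a b s i j :
  is_derive s (1:R) (fun r => E (a * r + b) i j) ((a *: (W *m E (a * s + b))) i j).
Proof.
have -> : a *: (W *m E (a * s + b)) =
    rfc W (fun l => complex.Complex 0 (- (a * l)) * cexp (a * s + b) l).
  rewrite -[X in X *m _](rfc_skew sW) /E rfcM; [|exact: sW|by []|exact: csym_cexp].
  by rewrite rfcZ; apply: rfc_ext => k; apply: eqC => /=; ring.
apply: is_derive_rfc => // l /=.
  apply: (@derive_ext _ (fun r => cos (a * l * r + b * l))).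
    by move=> r; congr cos; ring.
  have := derive_linear_cos (a * l) (b * l) s.
  rewrite (_ : a * l * s + b * l = (a * s + b) * l); last by ring.
  by congr is_derive; ring.
apply: (@derive_ext _ (fun r => - sin (a * l * r + b * l))).
  by move=> r; congr (- sin _); ring.
have := derive_opp (derive_linear_sin (a * l) (b * l) s).
rewrite (_ : a * l * s + b * l = (a * s + b) * l); last by ring.
by congr is_derive; ring.
Qed.

(** For l = 0 the symbol is s. Otherwise the product rule and the addition formulas combine the
    angles sl and (s-1)l into (2s-1)l. *)
Lemma derive_Y s i j : is_derive s (1:R) (fun r => Y r i j) (E (2 * s - 1) i j).
Proof.
apply: is_derive_rfc => // l; have [->|l0] := eqVneq l 0.
- rewrite /= mulr0 cos0; apply: derive_ext (derive_idfun s) => r.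
  by rewrite /csinc /sinc eqxx /= mulr0 cos0 sin0; ring.
- have D1 := derive_scale l^-1 (derive_linear_sin l 0 s).
  have := derive_mul D1 (derive_linear_cos l (- l) s).
  rewrite (_ : _ + _ = complex.Re (cexp (2 * s - 1) l)).
    apply: derive_ext => r; rewrite /csinc /sinc (negPf l0) /= addr0 (mulrC r) mulrBl mul1r.
    by rewrite (mulrC r); ring.
  rewrite /= (_ : (2 * s - 1) * l = (l * s + 0) + (l * s - l)); last by ring.
  by rewrite [RHS]cosD; field.
- rewrite /= mulr0 sin0 oppr0; apply: derive_ext (derive_cst 0 s) => r.
  by rewrite /csinc /sinc eqxx /= mulr0 cos0 sin0; ring.
- have D1 := derive_scale l^-1 (derive_linear_sin l 0 s).
  have := derive_opp (derive_mul D1 (derive_linear_sin l (- l) s)).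
  rewrite (_ : - (_ + _) = complex.Im (cexp (2 * s - 1) l)).
    apply: derive_ext => r; rewrite /csinc /sinc (negPf l0) /= addr0 (mulrC r) mulrBl mul1r.
    by rewrite (mulrC r); ring.
  rewrite /= (_ : (2 * s - 1) * l = (l * s + 0) + (l * s - l)); last by ring.
  by rewrite [in RHS]sinD; field.
Qed.

Lemma E0 : E 0 = 1%:M.
Proof.
rewrite -(rfc1 sW); apply: rfc_ext => k.
by rewrite /cexp mul0r cos0 sin0 oppr0.
Qed.

Lemma E_mul s t : E s *m E t = E (s + t).
Proof.
rewrite /E (rfcM sW (@csym_cexp s) (@csym_cexp t)).
by apply: rfc_ext => k; apply: eqC; rewrite /= mulrDl ?cosD ?sinD; ring.
Qed.

Lemma trE s : (E s)^T = E (- s).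
Proof.
rewrite tr_rfc; apply: rfc_ext => k.
by rewrite /cexp /Defs.conjc /= mulNr cosN sinN.
Qed.

Lemma E_isometry s a b : dotv (E s *m a) (E s *m b) = dotv a b.
Proof. by rewrite dotv_adj trE mulmxA E_mul addNr E0 mul1mx. Qed.

Lemma Y0 : Y 0 = 0.
Proof.
rewrite /Y (@rfc_ext _ _ _ _ (fun l => 0%:C * 1)) => [|k].
  by rewrite -rfcZ scale0r.
by rewrite /csinc /sinc mul0r sin0 mul0r if_same !mul0r.
Qed.

Lemma Y1 : Y 1 = rfc W (fun l => (sinc 1 l)%:C).
Proof.
apply: rfc_ext => k; rewrite /csinc subrr /cexp mul0r cos0 sin0 oppr0.
by apply: eqC => /=; ring.
Qed.

Definition rcsc := rfc W (fun l => (xcsc l)%:C).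
Definition rcot := rfc W (fun l => (xcot l)%:C).
(** The vector [c], which is the velocity at s = 1/2, is left free: the perturbation estimates vary
    it independently of the matrix. *)
Definition xlift c s : 'cV[R]_q := Y s *m c.
Definition vlift c s : 'cV[R]_q := E (2 * s - 1) *m c.

Lemma derivev_mulmxl (A : R -> 'M[R]_q) (dA : 'M[R]_q) c s :
  (forall i j, is_derive s (1:R) (fun r => A r i j) (dA i j)) ->
  is_derivev s (fun r => A r *m c) (dA *m c).
Proof.
move=> DA i; rewrite mxE.
have := derive_sum (fun j => derive_mul (DA i j) (derive_cst (c j 0) s)).
rewrite (_ : \sum_j _ = \sum_j dA i j * c j 0).
  by apply: derive_ext => r; rewrite mxE.
by apply: eq_bigr => j _; rewrite mulr0 addr0.
Qed.

Lemma derivev_xlift c s : is_derivev s (xlift c) (vlift c s).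
Proof. exact/derivev_mulmxl/derive_Y. Qed.

Lemma derivev_E a b c s :
  is_derivev s (fun r => E (a * r + b) *m c) (a *: (W *m (E (a * s + b) *m c))).
Proof. by rewrite mulmxA scalemxAl; apply: derivev_mulmxl => i j; exact: derive_E. Qed.

Lemma derivev_vlift c s : is_derivev s (vlift c) (2 *: (W *m vlift c s)).
Proof. exact: (derivev_E 2 (- 1)). Qed.

Lemma xlift0 c : xlift c 0 = 0. Proof. by rewrite /xlift Y0 mul0mx. Qed.

(** The form in which membership in [inV] is used: it is equivalent to invertibility of [Y 1], by
    [unit_regular] and [csc_Y1]. *)
Definition regular := forall i, sin (spec W i) = 0 -> spec W i = 0.

Lemma sinc1_neq0 l : (sinc 1 l == 0) = (sin l == 0) && (l != 0).
Proof.
rewrite /sinc; have [->|l0] := eqVneq l 0; first by rewrite oner_eq0 andbF.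
by rewrite mul1r mulf_eq0 invr_eq0 (negPf l0) orbF andbT.
Qed.

Lemma csym_sinc : csym (fun l => (sinc 1 l)%:C).
Proof. by apply: csym_real => l; exact: sincN. Qed.

Lemma csym_xcsc : csym (fun l : R => (xcsc l)%:C).
Proof. by apply: csym_real => l; exact: xcscN. Qed.

(** The determinant of [Y 1] is the product of the values sin(l)/l over the spectrum, and a factor
    vanishes exactly when l is a nonzero zero of sine. *)
Lemma unit_regular : Y 1 \in unitmx -> regular.
Proof.
rewrite unitmxE unitfE Y1 => d0 i si; apply/eqP; apply: contraNT d0 => li.
have := det_rfc sW csym_sinc.
rewrite (bigD1 i) //= (_ : sinc 1 _ = 0) ?mul0r; first by case=> ->.
by apply/eqP; rewrite sinc1_neq0 si eqxx.
Qed.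

Lemma csc_Y1 : regular -> rcsc *m Y 1 = 1%:M.
Proof.
move=> reg; rewrite Y1 /rcsc (rfcM sW csym_xcsc csym_sinc) -(rfc1 sW).
apply: rfc_ext => i; rewrite -rmorphM /xcsc /sinc; have := reg i.
case: eqVneq => [_ _|l0 s0]; first by rewrite mulr1.
have {}s0 : sin (spec W i) != 0 by apply: contra_neq l0.
by apply: eqC => //=; rewrite mul1r; field; apply/andP.
Qed.

(** On symbols, e^(-il) l / sin l = l cot l - il, and -il is the symbol of [W]. *)
Lemma vlift1 x0 : regular -> vlift (rcsc *m x0) 1 = rcot *m x0 + W *m x0.
Proof.
move=> reg; rewrite /vlift (mulmxA (E _)) -mulmxDl; congr (_ *m _).
rewrite /E /rcsc (rfcM sW (@csym_cexp _) csym_xcsc) -[X in _ = _ + X](rfc_skew sW) rfcD.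
apply: rfc_ext => i; have := reg i; rewrite /cexp /xcsc /xcot.
have -> : 2 * 1 - 1 = 1 :> R by ring.
rewrite mul1r; case: eqVneq => [->|l0 s0].
  by rewrite cos0 sin0 => _; apply: eqC => /=; ring.
have {}s0 : sin (spec W i) != 0 by apply: contra_neq l0.
by apply: eqC => /=; field.
Qed.

Lemma normv_E s a : normv (E s *m a) = normv a.
Proof. by rewrite /normv E_isometry. Qed.

Lemma rcscE : rcsc = rfc W (fun l => (xcsc l)%:C). Proof. by []. Qed.

Lemma rcotE : rcot = rfc W (fun l => (xcot l)%:C). Proof. by []. Qed.

(** Identifies the curve of the statement: sin(sl)/sin(l) factors as sin(sl)/l times l/sin(l), and
    the second factor is absorbed into the vector. *)
Lemma sin_ratio_expmx s x0 :
  rfc W (fun l => (sin_ratio s l)%:C) *m (expmx ((s - 1) *: W) *m x0) =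
  xlift (rcsc *m x0) s.
Proof.
rewrite (expmxE sW) /xlift (mulmxA (rfc _ _)) (mulmxA (Y s)) /Y /rcsc.
apply: (congr1 (mulmx^~ x0)).
have sr : csym (fun l => (sin_ratio s l)%:C) by apply: csym_real => l; exact: sin_ratioN.
rewrite (rfcM sW sr (@csym_cexp _)) (rfcM sW (@csym_csinc s) csym_xcsc).
apply: rfc_ext => i; rewrite /csinc mulrAC -rmorphM; congr (_%:C * _).
rewrite /sin_ratio /sinc /xcsc; case: eqVneq => [_|l0]; first by rewrite mulr1.
by rewrite mulrA divfK.
Qed.

Lemma csc_expmx s x0 :
  rcsc *m (expmx ((2 * s - 1) *: W) *m x0) = vlift (rcsc *m x0) s.
Proof.
rewrite (expmxE sW) /vlift (mulmxA rcsc) (mulmxA (E _)) /E /rcsc.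
apply: (congr1 (mulmx^~ x0)).
rewrite (rfcM sW csym_xcsc (@csym_cexp _)) (rfcM sW (@csym_cexp _) csym_xcsc).
by apply: rfc_ext => i; rewrite mulrC.
Qed.

Lemma xlift1 x0 : regular -> xlift (rcsc *m x0) 1 = x0.
Proof. by move=> reg; rewrite /xlift mulmxA (mulmx1C (csc_Y1 reg)) mul1mx. Qed.

End HorizontalLift.

(* Unfolding these during unification would compare functional calculi. *)
Global Opaque E Y rcsc rcot.

(** * Lipschitz dependence of the curve on the skew matrix *)

Section Perturbation.
Variables (R : realType) (q : nat) (W W' : 'M[R]_q) (M : R).
Hypotheses (sW : W^T = - W) (sW' : W'^T = - W').
Hypotheses (M0 : 0 <= M)
  (WM : forall a : 'cV[R]_q, normv ((W' - W) *m a) <= M * normv a).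
Implicit Types (v u : 'cV[R]_q) (s : R).

(** A Duhamel argument: g(r) = <E'(sr)v, E(sr)u> with E(s)u = b interpolates between <E(s)v, b> and
    <E'(s)v, b>. Its derivative involves only W' - W, and both flows are isometries, so the constant
    is [M] itself. *)
Lemma E_perturb s v : -1 <= s <= 1 -> normv (E W' s *m v - E W s *m v) <= M * normv v.
Proof.
move=> s1; have nv := normv_ge0 v.
apply: dotv_dual => [|b]; first by rewrite mulr_ge0.
pose u := E W (- s) *m b.
have bE : b = E W s *m u by rewrite mulmxA (E_mul sW) addrN (E0 sW) mul1mx.
have nb : normv b = normv u by rewrite bE normv_E.
pose g r := dotv (E W' (s * r + 0) *m v) (E W (s * r + 0) *m u).
have key a c : dotv (s *: (W' *m a)) c + dotv a (s *: (W *m c)) = s * dotv ((W' - W) *m a) c.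
  by rewrite mulmxBl dotvBl dotvZl dotvZr (dotvC a) (dotv_skew c a sW) mulrN mulrBr.
have Dg r : is_derive r (1:R) g
   (s * dotv ((W' - W) *m (E W' (s * r + 0) *m v)) (E W (s * r + 0) *m u)).
  have := derive_dotv (derivev_E sW' s 0 v r) (derivev_E sW s 0 u r).
  by congr is_derive; exact: key.
have gE : g 1 - g 0 = dotv (E W' s *m v - E W s *m v) b.
  rewrite /g !mulr0 !mulr1 !addr0 (E0 sW) (E0 sW') !mul1mx dotvBl {1}bE.
  by congr (_ - _); rewrite [in RHS]bE E_isometry.
rewrite -gE; apply: le_trans (derive_mean_value
  (M := M * normv v * normv b) ler01 (fun r _ => Dg r) _) _.
  move=> r _; apply: le_trans (ler_norm _) _; rewrite normrM.
  have h : `|dotv ((W' - W) *m (E W' (s * r + 0) *m v)) (E W (s * r + 0) *m u)|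
      <= M * normv v * normv b.
    apply: le_trans (norm_dotv _ _) _; rewrite (normv_E sW) -nb.
    apply: ler_wpM2r; first exact: normv_ge0.
    by have := WM (E W' (s * r + 0) *m v); rewrite normv_E.
  have : `|s| <= 1 by rewrite ler_norml.
  by move=> s1'; rewrite -[X in _ <= X]mul1r; exact: ler_pM.
by rewrite subr0 mulr1.
Qed.

Lemma xlift_perturb s v : 0 <= s <= 1 ->
  normv (xlift W' v s - xlift W v s) <= M * normv v.
Proof.
move=> /andP [s0 s1]; have nv := normv_ge0 v.
apply: dotv_dual => [|b]; first by rewrite mulr_ge0.
have Dg r := derive_dotv_cst b (derivev_sub (derivev_xlift W' v r) (derivev_xlift W v r)).
have := derive_mean_value (M := M * normv v * normv b) s0 (fun r _ => Dg r).
rewrite (xlift0 W) (xlift0 W') subrr (dotv0l b) !subr0 => h; apply: le_trans (h _) _.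
  move=> r /andP [r0 rs]; apply: le_trans (dotv_CS _ _) _.
  apply: ler_wpM2r; first exact: normv_ge0.
  (* For r in [0,1] the time 2r - 1 lies in [-1,1]. *)
  by apply: E_perturb; apply/andP; split; lra.
by rewrite ler_piMr // !mulr_ge0 // normv_ge0.
Qed.

Lemma normv_xlift s v : 0 <= s <= 1 -> normv (xlift W v s) <= normv v.
Proof.
move=> /andP [s0 s1]; have nv := normv_ge0 v.
rewrite -[X in _ <= X]mul1r; apply: dotv_dual => [|b]; first by rewrite mul1r.
have Dg r := derive_dotv_cst b (derivev_xlift W v r).
have := derive_mean_value (M := normv v * normv b) s0 (fun r _ => Dg r).
rewrite xlift0 dotv0l !subr0 => h; apply: le_trans (h _) _.
  move=> r /andP [r0 rs]; apply: le_trans (dotv_CS _ _) _.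
  by rewrite (normv_E sW).
by rewrite mul1r ler_piMr // mulr_ge0 // normv_ge0.
Qed.

Variable K : R.
Hypotheses (reg : regular W) (MK : M * K <= 2^-1) (K0 : 0 <= K)
  (ZK : forall a : 'cV[R]_q, normv (rcsc W *m a) <= K * normv a).

(** [rcsc W] inverts [Y W 1], so the error is [rcsc W] applied to (Y W' 1 - Y W 1)v, of norm at most
    K M |v|. *)
Lemma csc_Y_perturb v w : Y W' 1 *m v = w ->
  normv (rcsc W *m w - v) <= 2^-1 * normv v.
Proof.
move=> <-.
have -> : rcsc W *m (Y W' 1 *m v) - v = rcsc W *m (xlift W' v 1 - xlift W v 1).
  rewrite mulmxBr; congr (_ - _).
  by rewrite /xlift (mulmxA (rcsc W) (Y W 1) v) (csc_Y1 sW reg) mul1mx.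
apply: le_trans (ZK _) _; have nv := normv_ge0 v.
have := @xlift_perturb 1 v; rewrite ler01 lexx => /(_ isT) h.
have := ler_wpM2l K0 h; have := ler_wpM2r nv MK; lra.
Qed.

(** If [Y W' 1] kills v, then the preceding bound reads |v| <= |v|/2, so v = 0 and [Y W' 1] is
    invertible. *)
Lemma regular_perturb : regular W'.
Proof.
(* Kernels are taken on row vectors, hence the transpose. *)
apply: unit_regular => //; rewrite -unitmx_tr -row_free_unit; apply/row_freeP.
have /row_freeP // : row_free (Y W' 1)^T.
rewrite -kermx_eq0; apply/eqP/row_matrixP => i; rewrite row0.
have : row i (kermx (Y W' 1)^T) *m (Y W' 1)^T = 0.
  by rewrite -row_mul mulmx_ker row0.
move: (row i _) => u /(congr1 trmx); rewrite trmx_mul trmxK trmx0 => h.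
have := csc_Y_perturb h; rewrite mulmx0 sub0r normvN => h'.
have nu : normv u^T = 0 by have := normv_ge0 u^T; lra.
by rewrite -[u]trmxK (normv_eq0 nu) trmx0.
Qed.

(** The half bound first gives |c'| <= 2|c|. Then c' - c is minus [rcsc W] applied to the difference
    of the two flows of c' at time 1, since c' is sent to x_0 by the perturbed flow. *)
Lemma csc_perturb x0 :
  normv (rcsc W' *m x0 - rcsc W *m x0) <= K * M * (2 * normv (rcsc W *m x0)) /\
  normv (rcsc W' *m x0) <= 2 * normv (rcsc W *m x0).
Proof.
have Y1c : Y W' 1 *m (rcsc W' *m x0) = x0.
  by rewrite mulmxA (mulmx1C (csc_Y1 sW' regular_perturb)) mul1mx.
have h := csc_Y_perturb Y1c.
have h2 : normv (rcsc W' *m x0) <= 2 * normv (rcsc W *m x0).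
  have := normv_le_sub (rcsc W *m x0) (rcsc W' *m x0).
  by move: (normv _) (normv _) (normv _) h => a b d; lra.
split; last exact: h2.
move: (rcsc W' *m x0) Y1c h2 => c' Y1c h2.
have -> : c' - rcsc W *m x0 = - (rcsc W *m (xlift W' c' 1 - xlift W c' 1)).
  rewrite mulmxBr {1}/xlift Y1c opprB; congr (_ - _).
  by rewrite /xlift (mulmxA (rcsc W) (Y W 1) c') (csc_Y1 sW reg) mul1mx.
rewrite normvN; apply: le_trans (ZK _) _.
have := @xlift_perturb 1 c'; rewrite ler01 lexx => /(_ isT) e.
have e1 := ler_wpM2l K0 e; have e2 := ler_wpM2l (mulr_ge0 K0 M0) h2.
clear -e1 e2; move: (normv (_ *m _)) (normv c') (normv _) e1 e2 => a1 a2 a3 e1 e2.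
by apply: le_trans e1 _; rewrite (mulrA K M).
Qed.

Lemma curve_perturb x0 s : 0 <= s <= 1 ->
  normv (xlift W' (rcsc W' *m x0) s - xlift W (rcsc W *m x0) s)
  <= M * (2 * (1 + K) * normv (rcsc W *m x0)).
Proof.
move=> s01; have [h1 h2] := csc_perturb x0.
move: (rcsc W' *m x0) (rcsc W *m x0) h1 h2 => c' c h1 h2.
(* First the matrix changes with c' fixed, then the vector: the two costs are 2M|c| and 2KM|c|. *)
have -> : xlift W' c' s - xlift W c s =
    (xlift W' c' s - xlift W c' s) + xlift W (c' - c) s.
  have -> : xlift W (c' - c) s = xlift W c' s - xlift W c s by exact: mulmxBr.
  by move: (xlift _ _ _) (xlift W c' s) (xlift W c s) => a b d; rewrite addrA subrK.
apply: le_trans (normvD _ _) _.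
have e1 := xlift_perturb c' s01; have e2 := normv_xlift (c' - c) s01.
have := ler_wpM2l M0 h2.
move: (normv _) (normv (xlift _ _ _)) (normv (c' - c)) (normv c') (normv c)
  h1 h2 e1 e2 => a1 a2 a3 a4 a5.
lra.
Qed.

End Perturbation.

(** Dividing the remainder by h leaves an error of order |h|, so the difference quotient converges
    to [a]. *)
Lemma derive_quadratic_error (R : realType) (f : R -> R) (a K d : R) : 0 < d ->
  (forall h, `|h| <= d -> `|f h - f 0 - h * a| <= K * h ^+ 2) ->
  is_derive (0:R) (1:R) f a.
Proof.
move=> d0 H.
have cv : (fun h : R => h^-1 *: ((f \o shift 0) (h *: 1) - f 0)) @ 0^' --> a.
  apply/cvgrPdist_le => e e0.
  (* No sign of [K] is assumed, and a positive divisor is wanted. *)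
  pose M := `|K| + 1.
  have M0 : 0 < M by rewrite ltr_pwDr.
  near=> h.
  have h0 : h != 0 by near: h; exact: nbhs_dnbhs_neq.
  have hd : `|h| <= d by near: h; apply: dnbhs0_le.
  have he : `|h| <= e / M by near: h; apply: dnbhs0_le; rewrite divr_gt0.
  have hp : 0 < `|h| by rewrite normr_gt0.
  rewrite /= addr0 [_ *: 1]mulr1 /GRing.scale /=.
  rewrite -normrN opprB -(ler_pM2l hp) -normrM.
  have -> : h * (h^-1 * (f h - f 0) - a) = f h - f 0 - h * a.
    by rewrite mulrBr mulrA mulfV // mul1r.
  apply: le_trans (H _ hd) _.
  have -> : K * h ^+ 2 = K * `|h| * `|h| by rewrite -mulrA -expr2 real_normK ?num_real.
  rewrite [_ * e]mulrC ler_pM2r //.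
  apply: le_trans (_ : M * `|h| <= _); last by rewrite mulrC -ler_pdivlMr.
  apply: ler_wpM2r; first exact: normr_ge0.
  by rewrite /M; have := ler_norm K; lra.
split; first by apply/cvg_ex; exists a.
exact/cvg_lim.
Unshelve. all: by end_near. Qed.

(** * Derivative of the quadratic form of U cot U along W + h B *)

Section CotangentDerivative.
Variables (R : realType) (q : nat) (W B : 'M[R]_q) (x0 : 'cV[R]_q).
Hypotheses (sW : W^T = - W) (sB : B^T = - B) (reg : regular W).
Local Notation c := (rcsc W *m x0).

Lemma skewD_scale h : (W + h *: B)^T = - (W + h *: B).
Proof. by rewrite linearD linearZ /= sW sB scalerN opprD. Qed.

Lemma derive_rcot (T : R -> R) : T 0 = 0 ->
  (forall s : R, 0 <= s <= 1 -> is_derive s (1:R) T (dotv (B *m xlift W c s) (vlift W c s))) ->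
  is_derive (0:R) (1:R) (fun h => dotv (rcot (W + h *: B) *m x0) x0) (- (2 * T 1)).
Proof.
move=> T0 DT.
have [KB KB0 HB] := normv_mulmx B.
have [K K0 ZK] := normv_mulmx (rcsc W).
pose D := (2 * (1 + K) * normv c).
have D0 : 0 <= D by rewrite /D mulr_ge0 ?normv_ge0 // mulr_ge0 // addr_ge0.
(* The radius ensures |h| KB K <= 1/2, as the perturbation estimates require; the added 1 keeps it
   finite when KB K = 0. The constant is the bound [bd] on the derivative of [Q], divided by h^2. *)
apply: (@derive_quadratic_error _ _ _ (2 * KB * (KB * D) * normv c) (2 * (KB * K + 1))^-1).
  by rewrite invr_gt0 mulr_gt0 // ltr_wpDl // mulr_ge0.
move=> h hd; rewrite scale0r addr0.
pose W' := W + h *: B; have sW' : W'^T = - W' := skewD_scale h.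
pose M := `|h| * KB.
have M0 : 0 <= M by rewrite mulr_ge0.
have WM a : normv ((W' - W) *m a) <= M * normv a.
  rewrite /W' addrC addrA addNr add0r -scalemxAl.
  have -> : normv (h *: (B *m a)) = `|h| * normv (B *m a).
    by rewrite /normv dotvZl dotvZr mulrA -expr2 sqrtrM ?sqr_ge0 // sqrtr_sqr.
  by rewrite /M -mulrA ler_wpM2l.
have MK : M * K <= 2^-1.
  have kk : 0 <= KB * K by rewrite mulr_ge0.
  rewrite /M -mulrA; apply: le_trans (ler_wpM2r kk hd) _.
  by rewrite ler_pdivrMl; lra.
have reg' := regular_perturb sW sW' M0 WM reg MK K0 ZK.
have P := curve_perturb sW sW' M0 WM reg MK K0 ZK x0.
pose c' := rcsc W' *m x0.
pose x := xlift W c; pose y := xlift W' c'; pose dx := vlift W c; pose dy := vlift W' c'.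
(* By [vlift1], the velocity minus the matrix applied to the position equals [rcot] applied to x_0
   at s = 1; this is how both cotangent forms enter. *)
pose Q s := dotv (dy s - W' *m y s) (x s) - dotv (dx s - W *m x s) (y s)
  + h * dotv (B *m x s) (y s) + 2 * h * T s.
have DQ (s : R) : 0 <= s <= 1 -> is_derive s (1:R) Q (- (2 * h) * dotv (B *m (y s - x s)) (dx s)).
  move=> s01.
  have Dx := derivev_xlift W c s; have Dy := derivev_xlift W' c' s.
  have Ddx := derivev_vlift sW c s; have Ddy := derivev_vlift sW' c' s.
  have := derive_add (derive_add (derive_sub
     (derive_dotv (derivev_sub Ddy (derivev_mulmx W' Dy)) Dx)
     (derive_dotv (derivev_sub Ddx (derivev_mulmx W Dx)) Dy))
     (derive_scale h (derive_dotv (derivev_mulmx B Dx) Dy)))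
     (derive_scale (2 * h) (DT s s01)).
  congr is_derive.
  rewrite -/(x s) -/(y s) -/(dx s) -/(dy s).
  move: (x s) (y s) (dx s) (dy s) => a b da db.
  rewrite !(dotvBl, dotvBr, dotvZl, mulmxBr).
  have W'E v w : dotv (W' *m v) w = dotv (W *m v) w + h * dotv (B *m v) w.
    by rewrite mulmxDl dotvDl -scalemxAl dotvZl.
  rewrite !W'E (dotvC db da).
  have := dotv_skew db a sW; have := dotv_skew b da sW.
  have := dotv_skew db a sB; have := dotv_skew b da sB.
  move=> -> -> -> ->; ring.
have Q0 : Q 0 = 0.
  have x00 : x 0 = 0 by exact: xlift0.
  have y00 : y 0 = 0 by exact: xlift0.
  rewrite /Q x00 y00 T0 !dotv0r; ring.
have Q1 : Q 1 = dotv (rcot W' *m x0) x0 - dotv (rcot W *m x0) x0 - h * - (2 * T 1).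
  have x1 : x 1 = x0 := xlift1 sW x0 reg.
  have y1 : y 1 = x0 := xlift1 sW' x0 reg'.
  have dx1 : dx 1 = rcot W *m x0 + W *m x0 := vlift1 sW x0 reg.
  have dy1 : dy 1 = rcot W' *m x0 + W' *m x0 := vlift1 sW' x0 reg'.
  by rewrite /Q x1 y1 dx1 dy1 (addrK (W *m x0)) (addrK (W' *m x0)) (dotv_skew0 x0 sB); ring.
rewrite -/W' -Q1 -[Q 1]subr0 -Q0.
(* One factor h is explicit and the other comes from the Lipschitz bound on y - x. *)
have bd (s : R) : 0 <= s <= 1 -> `|- (2 * h) * dotv (B *m (y s - x s)) (dx s)|
    <= 2 * KB * (KB * D) * normv c * h ^+ 2.
  move=> s01; rewrite normrM normrN normrM ger0_norm //.
  have e1 := norm_dotv (B *m (y s - x s)) (dx s).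
  have e2 := HB (y s - x s).
  have e3 : normv (y s - x s) <= M * D := P s s01.
  have e4 : normv (dx s) = normv c by exact: normv_E.
  rewrite e4 in e1.
  have e5 : normv (B *m (y s - x s)) <= KB * (M * D).
    exact: le_trans e2 (ler_wpM2l KB0 e3).
  have e6 := le_trans e1 (ler_wpM2r (normv_ge0 _) e5).
  have h2 : 0 <= 2 * `|h| by rewrite mulr_ge0.
  have := ler_wpM2l h2 e6; congr (_ <= _).
  rewrite -(real_normK (num_real h)) /M; ring.
have u1 := derive_mean_value ler01 DQ (fun s s01 => le_trans (ler_norm _) (bd s s01)).
have bd' (s : R) (s01 : 0 <= s <= 1) := le_trans (ler_norm _)
  (eq_ind_r (fun z => z <= _) (bd s s01) (normrN _)).
have u2 := derive_mean_value ler01 (fun s s01 => derive_opp (DQ s s01)) bd'.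
rewrite subr0 mulr1 in u1; rewrite subr0 mulr1 in u2.
by move: (Q 1) (Q 0) u1 u2 => a b u1 u2; rewrite ler_norml; apply/andP; split; lra.
Qed.

End CotangentDerivative.

(** * Zeros of sine, antiderivatives, absolute continuity, and the energy identity *)

Lemma sin_eq0_gt0 (R : realType) (l : R) : 0 < l -> sin l = 0 ->
  exists2 k : nat, (0 < k)%N & l = k%:R * pi.
Proof.
move=> l0 s0; have p0 := @pi_gt0 R.
(* The remainder l - n pi lies in [0, pi), where sine is positive except at 0. *)
pose n := Num.truncn (l / pi).
have /andP [n1 n2] : n%:R <= l / pi < n.+1%:R by apply: truncn_itv; rewrite divr_ge0 // ltW.
rewrite ler_pdivlMr // in n1; rewrite ltr_pdivrMr // in n2.
have ln : l = n%:R * pi.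
  apply/eqP; rewrite eq_le n1 andbT leNgt; apply/negP => nl.
  have : 0 < sin (l - n%:R * pi).
    by apply: sin_gt0_pi; move: n2; rewrite -natr1 mulrDl mul1r => n2; apply/andP; split; lra.
  have : sin l = (-1) ^+ n * sin (l - n%:R * pi).
    by rewrite -(alternatingn (@sinDpi R)) -[pi *+ n]mulr_natl subrK.
  rewrite s0 => /esym/eqP; rewrite mulf_eq0 signr_eq0 /= => /eqP ->.
  by rewrite ltxx.
exists n => //; rewrite lt0n; apply/eqP => n0.
by move: l0; rewrite ln n0 mul0r ltxx.
Qed.

Section Antiderivative.
Variables (R : realType) (g : R -> R).
Hypothesis cg : continuous g.
Local Notation mu := (@lebesgue_measure R).

Lemma antiderivative_Rintegral : exists G : R -> R,
  (forall s : R, 0 <= s -> is_derive s (1:R) G (g s)) /\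
  (forall s : R, 0 <= s -> Rintegral mu `[0, s] g = G s - G 0).
Proof.
(* Starting the integral at -1 makes [G] differentiable from both sides at s = 0. *)
pose G s := Rintegral mu `[-1, s] g.
have DG (s : R) : 0 <= s -> is_derive s (1:R) G (g s).
  move=> s0; have s1 : -1 < s by lra.
  have [|||d e] := @continuous_FTC1_closed R g (-1) s (s + 1) _ _ s1 _.
  - by rewrite ltrDl.
  - apply: continuous_compact_integrable; first exact: segment_compact.
    exact: continuous_subspaceT.
  - exact: cg.
  by rewrite derive1E in e; split.
exists G; split=> // s; rewrite le_eqVlt => /orP [/eqP <-|s0].
  by rewrite set_itv1 Rintegral_set1 subrr.
have cG (t : R) : 0 <= t -> {for t, continuous G}.
  by move=> t0; apply/differentiable_continuous/derivable1_diffP; have [] := DG t t0.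
rewrite /Rintegral (@continuous_FTC2 R g G 0 s s0) //.
- exact: continuous_subspaceT.
- split.
  + by move=> t; rewrite in_itv /= => /andP [t0 _]; have [] := DG t (ltW t0).
  + exact/cvg_at_right_filter/cG.
  + exact/cvg_at_left_filter/cG/ltW.
- move=> t; rewrite in_itv /= => /andP [t0 _]; rewrite derive1E.
  by have := DG t (ltW t0) => D; rewrite derive_val.
Qed.

End Antiderivative.

(** A bounded derivative gives a Lipschitz function. The derivative is taken on [f1], which need
    agree with [f] only on [0,1], so the behaviour of [f] outside the interval does not matter. *)
Lemma abs_cont_bounded_derive (R : realType) (f f1 df : R -> R) (K : R) :
  (forall s : R, 0 <= s <= 1 -> f s = f1 s) ->
  (forall s : R, 0 <= s <= 1 -> is_derive s (1:R) f1 (df s)) ->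
  (forall s : R, 0 <= s <= 1 -> `|df s| <= K) -> abs_cont f 0 1.
Proof.
move=> ff1 D B e e0.
have K0 : 0 <= K.
  by apply: le_trans (normr_ge0 _) (B 0 _); rewrite lexx ler01.
have lip a b : 0 <= a -> a <= b -> b <= 1 -> `|f b - f a| <= K * (b - a).
  move=> a0 ab b1; rewrite !ff1; try (apply/andP; split; lra).
  have in01 s : a <= s <= b -> 0 <= s <= 1.
    by move=> /andP [? ?]; apply/andP; split; lra.
  have u1 := derive_mean_value ab (fun s h => D s (in01 s h))
    (fun s h => le_trans (ler_norm _) (B s (in01 s h))).
  have u2 := derive_mean_value ab (fun s h => derive_opp (D s (in01 s h)))
    (fun s h => le_trans (ler_norm _) (eq_ind_r (fun z => z <= K) (B s (in01 s h)) (normrN _))).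
  by rewrite ler_norml; apply/andP; split; lra.
exists (e / (K + 1)); first by rewrite divr_gt0 // ltr_wpDl.
move=> n u v uv _ hs.
apply: le_lt_trans (_ : K * \sum_k (v k - u k) < e).
  by rewrite mulr_sumr; apply: ler_sum => k _; have [? []] := uv k; exact: lip.
rewrite ltr_pdivlMr ?ltr_wpDl // in hs.
have : 0 <= \sum_k (v k - u k).
  by apply: sumr_ge0 => k _; have [_ [? _]] := uv k; rewrite subr_ge0.
lra.
Qed.

(** <x' - W x, x> + 2 S - |c|^2 s is constant: |x'| = |c|, x'' = 2 W x', and the remaining terms
    cancel by skewness. Comparing its values at 0 and 1 gives the identity. *)
Lemma energy_rcot (R : realType) (q : nat) (W : 'M[R]_q) (x0 : 'cV[R]_q) (S : R -> R) :
  W^T = - W -> regular W -> S 0 = 0 ->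
  (forall s : R, 0 <= s <= 1 -> is_derive s (1:R) S
     (dotv (W *m xlift W (rcsc W *m x0) s) (vlift W (rcsc W *m x0) s))) ->
  dotv (rcsc W *m x0) (rcsc W *m x0) = dotv (rcot W *m x0) x0 + 2 * S 1.
Proof.
move=> sW reg S0 DS; pose c := rcsc W *m x0.
pose x := xlift W c; pose dx := vlift W c.
pose Q s := dotv (dx s - W *m x s) (x s) + 2 * S s - dotv c c * s.
have DQ (s : R) : 0 <= s <= 1 -> is_derive s (1:R) Q 0.
  move=> s01.
  have Dx := derivev_xlift W c s; have Ddx := derivev_vlift sW c s.
  have := derive_sub (derive_add
     (derive_dotv (derivev_sub Ddx (derivev_mulmx W Dx)) Dx) (derive_scale 2 (DS s s01)))
     (derive_scale (dotv c c) (derive_idfun s)).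
  congr is_derive; have : dotv (vlift W c s) (vlift W c s) = dotv c c := E_isometry sW _ c c.
  rewrite -/(x s) -/(dx s).
  move: (x s) (dx s) => a da <-.
  rewrite !(dotvBl, dotvZl) (dotv_skew da a sW); ring.
have le0 (s : R) : 0 <= s <= 1 -> (0 : R) <= 0 by [].
have leN0 (s : R) : 0 <= s <= 1 -> (- 0 : R) <= 0 by rewrite oppr0.
have u1 := derive_mean_value ler01 DQ le0.
have u2 := derive_mean_value ler01 (fun s s01 => derive_opp (DQ s s01)) leN0.
have Q0 : Q 0 = 0.
  have x00 : x 0 = 0 by exact: xlift0.
  by rewrite /Q x00 S0 dotv0r; ring.
have Q1 : Q 1 = dotv (rcot W *m x0) x0 + 2 * S 1 - dotv c c.
  have x1 : x 1 = x0 := xlift1 sW x0 reg.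
  have dx1 : dx 1 = rcot W *m x0 + W *m x0 := vlift1 sW x0 reg.
  by rewrite /Q x1 dx1 (addrK (W *m x0)) mulr1.
rewrite mul0r in u1; rewrite mul0r in u2; rewrite -/c.
by move: (Q 0) (Q 1) Q0 Q1 u1 u2 => a b -> -> u1 u2; lra.
Qed.

(** * The curve of the statement: critical points, horizontality and length *)

Section Geodesic.
Variables (R : realType) (q m : nat) (Us : 'I_m -> 'M[R]_q).
Variables (x0 : 'cV[R]_q) (th0 : 'cV[R]_m).
Hypothesis sUs : forall j, (Us j)^T = - Us j.
Local Notation W := (Utilde Us th0).
Local Notation c := (rcsc W *m x0).
Local Notation mu := (@lebesgue_measure R).

Lemma Utilde_skew th : (Utilde Us th)^T = - Utilde Us th.
Proof.
rewrite /Utilde linear_sum -sumrN; apply: eq_bigr => j _.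
by rewrite linearZ /= sUs scalerN.
Qed.

Let sW := Utilde_skew th0.

Lemma UtildeD j h : Utilde Us (th0 + h *: delta_mx j 0) = W + h *: Us j.
Proof.
rewrite /Utilde (eq_bigr (fun k => th0 k 0 *: Us k + (h * (k == j)%:R) *: Us k)).
  rewrite big_split /=; congr (_ + _); rewrite (bigD1 j) //= eqxx mulr1.
  by rewrite big1 ?addr0 // => k /negPf ->; rewrite mulr0 scale0r.
by move=> k _; rewrite !mxE eqxx andbT scalerDl.
Qed.

Lemma dotv_Utilde a b : dotv (W *m a) b = \sum_j th0 j 0 * dotv (Us j *m a) b.
Proof.
rewrite /Utilde mulmx_suml.
elim/big_ind2: _ => [|u v y z e1 e2|j _]; first exact: dotv0l.
  by rewrite dotvDl e1 e2.
by rewrite -scalemxAl dotvZl.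
Qed.

Lemma mxfE (f : R -> R) th : mxf Us f th = rfc (Utilde Us th) (fun l => real_complex R (f l)).
Proof. by rewrite /mxf /rfc -fcalcE. Qed.

Lemma xcurveE : xcurve Us x0 th0 = xlift W c.
Proof. by apply/funext => s; rewrite /xcurve mxfE sin_ratio_expmx. Qed.

Lemma zetaE : zeta Us x0 th0 = vlift W c.
Proof. by apply/funext => s; rewrite /zeta mxfE -rcscE csc_expmx. Qed.

(** A nonzero eigenvalue at a zero of sine equals k pi or -k pi with k > 0, which makes the
    corresponding determinant vanish. *)
Lemma inV_regular : inV Us th0 -> regular W.
Proof.
move=> V i s0; apply/eqP/negP => /negP li.
(* Transposing changes the sign of U, so a negative eigenvalue -k pi is also excluded by the
   determinant at k pi. *)
have tr k : ((RtoC k)%:M - Uc Us th0)^T = (RtoC k)%:M + real_complex R 1 *: imx W.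
  by rewrite linearB /= tr_scalar_mx rmorph1 scale1r [(Uc _ _)^T](tr_imx sW) opprK.
have [l0|l0|l0] := ltgtP (spec W i) 0; last by rewrite l0 eqxx in li.
  have := @sin_eq0_gt0 R (- spec W i); rewrite oppr_gt0 sinN s0 oppr0.
  case=> // k k0 e; have /eqP := V k k0; apply.
  rewrite -det_tr tr (det_pencil sW) (bigD1 i) //= -e mul1r addNr.
  by rewrite rmorph0 mul0r.
have [k k0 e] := sin_eq0_gt0 l0 s0; have /eqP := V k k0; apply.
have -> : (RtoC (k%:R * pi))%:M - Uc Us th0 =
    (RtoC (k%:R * pi))%:M + real_complex R (- 1) *: imx W.
  by rewrite rmorphN rmorph1 scaleN1r.
by rewrite (det_pencil sW) (bigD1 i) //= -e mulN1r subrr rmorph0 mul0r.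
Qed.

Definition area j (s : R) := dotv (Us j *m xlift W c s) (vlift W c s).

Lemma continuous_area j : continuous (area j).
Proof.
move=> s; apply/differentiable_continuous/derivable1_diffP.
by have [] := derive_dotv (derivev_mulmx (Us j) (derivev_xlift W c s)) (derivev_vlift sW c s).
Qed.

(** [tcurve] integrates over an empty set when s < 0; [T] replaces it by a function with the right
    two-sided derivative at 0 as well. *)
Lemma tcurve_antiderivative j : exists2 T : R -> R,
   T 0 = 0 /\ (forall s : R, 0 <= s -> is_derive s (1:R) T (area j s)) &
   forall s : R, 0 <= s -> tcurve Us x0 th0 s j 0 = 2^-1 * T s.
Proof.
have [G [DG GE]] := antiderivative_Rintegral (@continuous_area j).
exists (fun s => G s - G 0); first split; first by rewrite subrr.
  move=> s s0; have := derive_sub (DG s s0) (derive_cst (G 0) s).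
  by rewrite subr0.
by move=> s s0; rewrite mxE xcurveE zetaE GE.
Qed.

(** The quadratic form contributes -2 T(1) = -4 t_j(1), and the linear term contributes 4
    (t_0)_j. *)
Lemma derive_phi t0 j : regular W ->
  is_derive (0:R) (1:R) (fun h => phi Us (x0, t0) (th0 + h *: delta_mx j 0))
    (4 * (t0 j 0 - tcurve Us x0 th0 1 j 0)).
Proof.
move=> reg; have [T [T0 DT] tE] := tcurve_antiderivative j.
have DT01 (s : R) : 0 <= s <= 1 -> is_derive s (1:R) T (area j s).
  by move=> /andP [s0 _]; exact: DT.
have D1 := derive_rcot sW (sUs j) reg T0 DT01.
have := derive_add D1 (derive_add (derive_cst (4 * dotv t0 th0) 0)
   (derive_scale (4 * t0 j 0) (derive_idfun 0))).
rewrite tE // (_ : - (2 * T 1) + _ = 4 * (t0 j 0 - 2^-1 * T 1)); last by field.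
apply: derive_ext => h; rewrite /phi mxfE UtildeD -rcotE /=.
rewrite dotvDr dotvZr; congr (_ + _).
have -> : dotv t0 (delta_mx j 0) = t0 j 0.
  rewrite /dotv (bigD1 j) //= mxE !eqxx mulr1 big1 ?addr0 // => k /negPf kj.
  by rewrite mxE kj mulr0.
ring.
Qed.

Lemma critical_phi t0 : regular W ->
  critical (phi Us (x0, t0)) th0 <-> t0 = tcurve Us x0 th0 1.
Proof.
move=> reg; split => [cr | -> j].
  apply/colP => j; have D := derive_phi t0 j reg; have [_] := cr j.
  by rewrite derive1E derive_val; lra.
have D := derive_phi (tcurve Us x0 th0 1) j reg.
by split; [exact: ex_derive | rewrite derive1E derive_val subrr mulr0].
Qed.

Lemma xdot_gamma s : xdot (gamma Us x0 th0) s = vlift W c s.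
Proof.
apply/colP => i; rewrite mxE derive1E /gamma /= xcurveE.
by have D := derivev_xlift W c s i; rewrite derive_val.
Qed.

Lemma horizontal_gamma : horizontal Us (gamma Us x0 th0).
Proof.
have nv s : normv (vlift W c s) = normv c by exact: normv_E.
split.
- move=> i; apply: (abs_cont_bounded_derive (f1 := fun s => xlift W c s i 0)
    (df := fun s => vlift W c s i 0) (K := normv c)).
  + by move=> s _; rewrite /= xcurveE.
  + by move=> s _; exact: derivev_xlift.
  + by move=> s _; rewrite -(nv s); exact: norm_entry.
- move=> j; have [T [T0 DT] tE] := tcurve_antiderivative j.
  have [K K0 HK] := normv_mulmx (Us j).
  apply: (abs_cont_bounded_derive (f1 := fun s => 2^-1 * T s)
    (df := fun s => 2^-1 * area j s) (K := K * normv c * normv c)).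
  + by move=> s /andP [s0 _]; rewrite /= tE.
  + by move=> s /andP [s0 _]; apply: derive_scale; exact: DT.
  + move=> s s01; rewrite normrM ger0_norm ?invr_ge0 //.
    have e1 := norm_dotv (Us j *m xlift W c s) (vlift W c s); rewrite nv in e1.
    have e2 := ler_wpM2l K0 (normv_xlift sW c s01).
    have e3 := ler_wpM2r (normv_ge0 c) (le_trans (HK _) e2).
    have := le_trans e1 e3; rewrite -/(area j s).
    have := normr_ge0 (area j s); move: `|area j s| => a; lra.
(* The exceptional null set is {0}: for s > 0, [tcurve] equals T/2 on a whole neighbourhood of s. *)
- exists [set (0:R)]; split; first exact: measurable_set1.
    exact: lebesgue_measure_set1.
  move=> s /= /not_implyP [s01 H]; apply: contrapT => s0; apply: H.
  have {}s0 : 0 < s by move: s01 => /andP [? _]; rewrite lt_def; apply/andP; split => //; apply/eqP.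
  split => [i|j].
    by have [] := derivev_xlift W c s i; rewrite xcurveE.
  have [T [T0 DT] tE] := tcurve_antiderivative j.
  have D : is_derive s (1:R) (fun r => tcurve Us x0 th0 r j 0) (2^-1 * area j s).
    apply: near_eq_is_derive (derive_scale 2^-1 (DT s (ltW s0))).
    near=> r; rewrite tE //; apply/ltW; near: r; exact: lt_nbhsr.
  split; first exact: ex_derive.
  by rewrite xdot_gamma derive1E derive_val /= xcurveE.
Unshelve. all: by end_near. Qed.

Lemma len_gamma : len (gamma Us x0 th0) = (normv c)%:E.
Proof.
rewrite /len (eq_integral (cst (normv c)%:E)).
  rewrite integral_cst //= lebesgue_measure_itv /= lte_fin ltr01.
  by rewrite oppr0 adde0 mule1.
by move=> s _; rewrite xdot_gamma [normv _](normv_E sW).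
Qed.

Lemma len_ge0 (gam : curve R q m) : (0 <= len gam)%E.
Proof. by apply: integral_ge0 => s _; rewrite lee_fin normv_ge0. Qed.

Lemma ccdist_ge0 g : (0 <= ccdist Us g)%E.
Proof. by apply: le_ereal_inf_tmp => _ [gam _ <-]; exact: len_ge0. Qed.

(** The energy identity with S = sum of theta_j T_j: since t_j(1) = T_j(1)/2, the term 2 S(1) is 4
    t(1).theta. *)
Lemma normv_csc_phi : regular W ->
  normv c ^+ 2 = phi Us (x0, tcurve Us x0 th0 1) th0.
Proof.
move=> reg; rewrite sqr_normv.
have /choice [T HT] : forall j, exists T : R -> R, [/\ T 0 = 0,
   (forall s : R, 0 <= s -> is_derive s (1:R) T (area j s)) &
   forall s : R, 0 <= s -> tcurve Us x0 th0 s j 0 = 2^-1 * T s].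
  by move=> j; have [T [] *] := tcurve_antiderivative j; exists T.
pose S s := \sum_j th0 j 0 * T j s.
have S0 : S 0 = 0 by rewrite /S big1 // => j _; have [-> _ _] := HT j; rewrite mulr0.
have DS (s : R) : 0 <= s <= 1 ->
    is_derive s (1:R) S (dotv (W *m xlift W c s) (vlift W c s)).
  move=> /andP [s0 _]; rewrite dotv_Utilde; apply: derive_sum => j.
  by apply: derive_scale; have [_ D _] := HT j; exact: D.
rewrite (energy_rcot sW reg S0 DS) /phi mxfE -rcotE /=; congr (_ + _).
rewrite /dotv /S !mulr_sumr; apply: eq_bigr => j _.
by have [_ _ ->] := HT j; [field | exact: ler01].
Qed.

End Geodesic.

(** * Assembly of the theorem *)

Unset Implicit Arguments.

Theorem theorem2p5 (R : realType) (q m : nat) (Us : 'I_m -> 'M[R]_q)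
    (x0 : 'cV[R]_q) (th0 : 'cV[R]_m) :
  (0 < q)%N -> (0 < m)%N ->
  (forall j, (Us j)^T = - Us j) ->
  (forall c : 'I_m -> R, \sum_(j < m) c j *: Us j = 0 -> forall j, c j = 0) ->
  x0 != 0 -> inV Us th0 ->
  (forall t0 : 'cV[R]_m, critical (phi Us (x0, t0)) th0 ->
     [/\ horizontal Us (gamma Us x0 th0),
         gamma Us x0 th0 0 = origin R q m /\ gamma Us x0 th0 1 = (x0, t0),
         (ccdist Us (x0, t0) * ccdist Us (x0, t0)
            <= len (gamma Us x0 th0) * len (gamma Us x0 th0))%E,
         len (gamma Us x0 th0) = (normv (mxf Us (@xcsc R) th0 *m x0))%:E
       & normv (mxf Us (@xcsc R) th0 *m x0) ^+ 2 = phi Us (x0, t0) th0]) /\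
  critical (phi Us (x0, tcurve Us x0 th0 1)) th0.
Proof.
move=> _ _ sUs _ _ /(inV_regular sUs) reg.
split; last exact/(@critical_phi R q m Us x0 th0 sUs _ reg).
move=> t0 /(@critical_phi R q m Us x0 th0 sUs _ reg) ->.
have g0 : gamma Us x0 th0 0 = origin R q m.
  congr pair; first by rewrite (xcurveE x0 th0 sUs); exact: xlift0.
  apply/colP => j; have [T [T0 _] ->] := tcurve_antiderivative x0 th0 sUs j; last exact: lexx.
  by rewrite T0 mulr0 mxE.
have g1 : gamma Us x0 th0 1 = (x0, tcurve Us x0 th0 1).
  by congr pair; rewrite (xcurveE x0 th0 sUs); exact: (xlift1 (Utilde_skew sUs th0) x0 reg).
have hor := horizontal_gamma x0 th0 sUs.
split=> //.
(* The curve competes in the infimum; both sides are nonnegative, so the inequality may be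
   squared. *)
- have dl : (ccdist Us (x0, tcurve Us x0 th0 1) <= len (gamma Us x0 th0))%E.
    by apply: ereal_inf_lbound; exists (gamma Us x0 th0).
  by apply: lee_pmul => //; exact: ccdist_ge0.
- by rewrite (len_gamma x0 th0 sUs) mxfE -rcscE.
- by rewrite mxfE -rcscE (normv_csc_phi x0 sUs reg).
Qed.
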